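(* Let $\{T_w\}_{w\in U}$ be an interpolating family of operators between two interpolation scales $\{X_w\}_{w\in U}$ and $\{Y_w\}_{w\in U}$, and assume that $\eta(T_{w_0})$ is strictly positive at some point $w_0\in U$. Then there exist a neighborhood $\omega$ of $w_0$ in $U$ and a constant $C$ such that $0<C\le\eta(T_z)$ for each $z\in\omega$.
   Context: All quasi-norms are assumed continuous. Fix a Hausdorff, locally compact, locally connected topological space $U$ (the space of parameters) and a continuous function $\delta:U\times U\to\mathbb{C}$ such that $\delta(z,w)=0$ if and only if $z=w$. Let $Z$ be a Hausdorff complex topological vector space (the ambient space). A family $\mathcal{F}$ of functions $U\to Z$ is called admissible (relative to $U,\delta,Z$) if: (1) $\mathcal{F}$ is a complex vector space with a quasi-norm $\|\cdot\|_{\mathcal{F}}$ for which it is complete; (2) for each $w\in U$ the evaluation map $\mathcal{F}\to Z$, $f\mapsto f(w)$, is continuous; (3) for each compact $K\subseteq U$ there is a positive constant $D_K(\mathcal{F})$ such that for any $w\in K$ and any $f\in\mathcal{F}$ with $f(w)=0$, the map $U\setminus\{w\}\ni z\mapsto f(z)/\delta(z,w)\in Z$ extends to an element of $\mathcal{F}$ with $\left\|f(\cdot)/\delta(\cdot,w)\right\|_{\mathcal{F}}\le D_K(\mathcal{F})\|f\|_{\mathcal{F}}$. The intermediate spaces are $X_w:=\{f(w): f\in\mathcal{F}\}\subseteq Z$, $w\in U$, with quasi-norm $\|x\|_w:=\inf\{\|f\|_{\mathcal{F}}: f\in\mathcal{F},\ f(w)=x\}$; they are quasi-Banach spaces. The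 collection $\{X_w\}_{w\in U}$ is called an interpolation scale. Let $\{X_w\}_{w\in U}$ be an interpolation scale with ambient space $Z$ and admissible family $\mathcal{F}$, and $\{Y_w\}_{w\in U}$ an interpolation scale with ambient space $W$ and admissible family $\mathcal{G}$ (same $U$ and $\delta$). A family of operators $T_w:X_w\to W$, $w\in U$, is called an interpolating family of operators if the assignment $\mathcal{F}\ni f\mapsto[U\ni w\mapsto T_w(f(w))]\in\mathcal{G}$ is well defined, linear, and satisfies $\|T_{\cdot}(f(\cdot))\|_{\mathcal{G}}\le M\|f\|_{\mathcal{F}}$ for all $f\in\mathcal{F}$, for some finite $M>0$. Then each $T_w$ maps $X_w$ linearly and boundedly into $Y_w$. For quasi-Banach spaces $X,Y$ and a bounded linear $T:X\to Y$, $\eta(T;X,Y)$ is the largest constant such that $\eta(T;X,Y)\|x\|_X\le\|Tx\|_Y$ for each $x\in X$ (it is strictly positive iff $T$ is injective with closed range). Write $\eta(T_w):=\eta(T_w;X_w,Y_w)$. *)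

(* Defs.v *)
From HB Require Import structures.
From mathcomp Require Import all_boot all_order all_algebra.
From mathcomp Require Import complex.
From mathcomp Require Import all_classical all_reals all_analysis.

Set Implicit Arguments.
Unset Strict Implicit.
Unset Printing Implicit Defensive.

Import Order.TTheory GRing.Theory Num.Theory.
Import numFieldNormedType.Exports.

Local Open Scope classical_set_scope.
Local Open Scope ring_scope.
Local Open Scope complex_scope.

Definition locally_connected (T : topologicalType) : Prop :=
  forall (x : T) (V : set T), nbhs x V ->
    exists B : set T, [/\ open B, connected B, B x & B `<=` V].

(* A quasi-normed space is given by a linear subspace X of an ambient complex
   vector space V together with a function N : V -> R, of which only the
   values on X are relevant. *)
Section QuasiNormedSpaces.
Variables (R : realType) (V : lmodType R[i]).
Implicit Types (X : set V) (N : V -> R).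

Definition linear_subspace X : Prop :=
  X 0 /\ forall (a : R[i]) x y, X x -> X y -> X (a *: x + y).

Record quasi_norm X N : Prop := QuasiNorm {
  quasi_norm_ge0 : forall x, X x -> 0 <= N x ;
  quasi_norm_eq0 : forall x, X x -> N x = 0 -> x = 0 ;
  quasi_normZ : forall (a : R[i]) x, X x ->
    N (a *: x) = ComplexField.Normc.normc a * N x ;
  quasi_normD : exists2 k : R, 1 <= k &
    forall x y, X x -> X y -> N (x + y) <= k * (N x + N y) }.

(* Traces on X of the neighbourhoods of x for the topology of (X, N): balls
   need not be open, but they form a base of neighbourhoods. *)
Definition quasi_norm_nbhs X N (x : V) : set_system V :=
  filter_from [set e : R | 0 < e]
    (fun e => [set y | X y /\ N (y - x) < e]).

Definition continuous_quasi_norm X N : Prop :=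
  forall x, X x -> N y @[y --> quasi_norm_nbhs X N x] --> N x.

Definition quasi_norm_complete X N : Prop :=
  forall u : nat -> V, (forall n, X (u n)) ->
    (forall e : R, 0 < e -> exists n0 : nat, forall m n,
      (n0 <= m)%N -> (n0 <= n)%N -> N (u m - u n) < e) ->
    exists2 l, X l & u n @[n --> \oo] --> quasi_norm_nbhs X N l.

Definition quasi_banach X N : Prop :=
  [/\ linear_subspace X, quasi_norm X N, continuous_quasi_norm X N
    & quasi_norm_complete X N].

End QuasiNormedSpaces.

(* The supremum is a maximum, except that it is +oo when X is zero, every
   constant being admissible in that case. *)
Definition eta_op (R : realType) (V V' : lmodType R[i]) (X : set V)
    (NX : V -> R) (NY : V' -> R) (T : V -> V') : \bar R :=
  ereal_sup [set c%:E | c in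
    [set c : R | forall x, X x -> c * NX x <= NY (T x)]].

Section InterpolationScales.
Variables (R : realType) (U : topologicalType) (delta : U -> U -> R[i]).

Record parameter_space : Prop := ParameterSpace {
  parameter_hausdorff : hausdorff_space U ;
  parameter_locally_compact : locally_compact [set: U] ;
  parameter_locally_connected : locally_connected U ;
  parameter_continuous : continuous (fun zw : U * U => delta zw.1 zw.2 : R[i]^o) ;
  parameter_eq0 : forall z w, delta z w = 0 <-> z = w }.

Record admissible (Z : topologicalLmodType R[i]) (F : set (U -> Z))
    (N : (U -> Z) -> R) : Prop := Admissible {
  admissible_quasi_banach : quasi_banach F N ;
  admissible_eval : forall (w : U) f, F f ->
    g w @[g --> quasi_norm_nbhs F N f] --> f w ;
  admissible_div : forall K : set U, compact K ->
    exists2 D : R, 0 < D & forall w f, K w -> F f -> f w = 0 ->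
      exists g : U -> Z,
        [/\ F g, forall z, z <> w -> g z = (delta z w)^-1 *: f z
          & N g <= D * N f] }.

Definition intermediate (Z : topologicalLmodType R[i]) (F : set (U -> Z))
    (w : U) : set Z :=
  [set f w | f in F].

Definition intermediate_norm (Z : topologicalLmodType R[i])
    (F : set (U -> Z)) (N : (U -> Z) -> R) (w : U) (x : Z) : R :=
  inf [set N f | f in [set f | F f /\ f w = x]].

(* Only the restriction of T w to intermediate F w matters: the operator
   X_w -> W is represented by any of its extensions to Z. *)
Definition interpolating (Z W : topologicalLmodType R[i])
    (F : set (U -> Z)) (NF : (U -> Z) -> R)
    (G : set (U -> W)) (NG : (U -> W) -> R) (T : U -> Z -> W) : Prop :=
  let Phi (f : U -> Z) : U -> W := fun w => T w (f w) in
  [/\ forall f, F f -> G (Phi f),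
      forall (a : R[i]) f g, F f -> F g ->
        Phi (a *: f + g) = a *: Phi f + Phi g
    & exists2 M : R, 0 < M & forall f, F f -> NG (Phi f) <= M * NF f].

End InterpolationScales.

(* Main.v *)
Require Import Defs.
From HB Require Import structures.
From mathcomp Require Import all_boot all_order all_algebra.
From mathcomp Require Import complex lra.
From mathcomp Require Import all_classical all_reals all_analysis.
Set Implicit Arguments.
Unset Strict Implicit.
Unset Printing Implicit Defensive.
Import Order.TTheory GRing.Theory Num.Theory.
Import numFieldNormedType.Exports.
Local Open Scope classical_set_scope.
Local Open Scope ring_scope.

(** Two elements of an admissible family that agree at [w] differ by
    [delta(., w) k] with [k] controlled, so their values at a nearby point are
    close in the intermediate space there. Given [x] of norm about [a] at [z]
    whose image has small norm, represent [x] by [f] and [T_z x] by a small [h]: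
    comparing the image of [f] with [h] at [w0] shows that [T_w0 (f w0)] is
    small, hence so is [f w0] by the lower bound at [w0]. Comparing [f] with a
    small representative of [f w0] then makes [f z = x] smaller than [a]. *)

(** The single choice [q / (p + q)] meets both upper bounds at once. All thresholds of the theorem
    are drawn from here. *)
Lemma ex_small_factor (R : realFieldType) (p q : R) :
  0 < p -> 0 < q -> exists t : R, [/\ 0 < t, t <= 1 & p * t <= q].
Proof.
move=> p0 q0; have pq0 : 0 < p + q by rewrite addr_gt0.
exists (q / (p + q)); split; first by rewrite divr_gt0.
  by rewrite ler_pdivrMr // mul1r lerDr ltW.
by rewrite mulrA ler_pdivrMr // mulrC ler_pM2l // lerDl ltW.
Qed.

Lemma normc_ge0 (R : rcfType) (x : R[i]) : 0 <= ComplexField.Normc.normc x.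
Proof. by case: x => a b; exact: sqrtr_ge0. Qed.

Section AdmissibleFamilies.
Variables (R : realType) (U : topologicalType) (delta : U -> U -> R[i]).
Hypothesis hU : parameter_space delta.

(** Both orders of the arguments are covered: [delta] need not be symmetric, and the two points
    exchange roles between the two comparisons of the theorem. *)
Lemma nbhs_delta_small (w0 : U) (d : R) : 0 < d ->
  \forall z \near w0, ComplexField.Normc.normc (delta w0 z) < d /\
                      ComplexField.Normc.normc (delta z w0) < d.
Proof.
move=> d0.
have dC0 : 0 < (d%:C)%C :> R[i] by rewrite ltcR.
have small (u v : U -> U) : u z @[z --> w0] --> w0 -> v z @[z --> w0] --> w0 ->
    \forall z \near w0, ComplexField.Normc.normc (delta (u z) (v z)) < d.
  move=> cu cv.
  have cd : (delta (u z) (v z) : R[i]^o) @[z --> w0] --> (0 : R[i]^o).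
    rewrite -[X in _ --> X]((parameter_eq0 hU w0 w0).2 erefl).
    apply: (cvg_comp2 cu cv (h := fun a b => delta a b : R[i]^o)).
    exact: (@parameter_continuous _ _ _ hU (w0, w0)).
  apply: filterS (cvgr0_norm_lt _ cd _ dC0) => z.
  by rewrite -ltcR.
apply: filterI; first exact: small (fun=> w0) id (cvg_cst w0) cvg_id.
exact: small id (fun=> w0) cvg_id (cvg_cst w0).
Qed.

Section Family.
Variables (Z : topologicalLmodType R[i]) (F : set (U -> Z)).
Variables (N : (U -> Z) -> R).
Hypothesis hF : admissible delta F N.

Lemma admissible_norm_ge0 f : F f -> 0 <= N f.
Proof.
by have [_ [+ _ _ _] _ _] := admissible_quasi_banach hF; apply.
Qed.

Lemma intermediate_norm_le w f : F f -> intermediate_norm F N w (f w) <= N f.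
Proof.
move=> Ff; apply: ge_inf; last by exists f.
by exists 0 => _ [g [Fg _] <-]; exact: admissible_norm_ge0.
Qed.

Lemma intermediate_norm_ge0 w x : 0 <= intermediate_norm F N w x.
Proof.
rewrite /intermediate_norm; set S := [set _ | _ in _].
(* When [x] has no representative at [w] the set is empty and its infimum is 0 by convention. *)
have [->|/set0P S0] := eqVneq S set0; first by rewrite inf0.
by apply: lb_le_inf S0 _ => _ [g [Fg _] <-]; exact: admissible_norm_ge0.
Qed.

Lemma intermediate_norm_lt w x (r : R) :
  intermediate F w x -> intermediate_norm F N w x < r ->
  exists f, [/\ F f, f w = x & N f < r].
Proof.
move=> [f0 Ff0 f0w] /inf_lt [|_ [f [Ff fw] <-] ltr]; last by exists f.
by exists (N f0), f0.
Qed.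

(** Dividing [f - h] by [delta(., w)] stays in the family, with a bound uniform over [K]; hence one
    [A] serves every [w] in [K] and every [z]. *)
Lemma intermediate_norm_perturb (K : set U) : compact K ->
  exists2 A : R, 0 < A & forall w z f h, K w -> F f -> F h -> f w = h w ->
    intermediate_norm F N z (f z) <=
    A * (N h + ComplexField.Normc.normc (delta z w) * (N f + N h)).
Proof.
move=> cK; have [D D0 HD] := admissible_div hF cK.
have [[F0 lin] [_ _ NZ [k k1 ND]] _ _] := admissible_quasi_banach hF.
have k0 : 0 < k by exact: lt_le_trans k1.
(* The outer [k] comes from splitting [h + delta z w *: g]; [D * k] bounds [N g] through the
   quasi-triangle inequality for [f - h]. *)
exists (k * (1 + D * k)).
  by rewrite mulr_gt0 // addr_gt0 // mulr_gt0.
move=> w z f h Kw Ff Fh fh.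
have FZ a g : F g -> F (a *: g) by move=> Fg; rewrite -[_ *: _]addr0; exact: lin.
have FD g g' : F g -> F g' -> F (g + g').
  by move=> Fg Fg'; rewrite -[g]scale1r; exact: lin.
have normN1 : ComplexField.Normc.normc (-1 : R[i]) = 1.
  by rewrite -(ComplexField.Normc.normc1 R); exact: normcN.
have Ffh : F (f - h) by rewrite -scaleN1r; apply: (FD _ _ Ff); exact: FZ.
have Nfh : N (f - h) <= k * (N f + N h).
  rewrite -scaleN1r; apply: le_trans (ND _ _ Ff (FZ _ _ Fh)) _.
  by rewrite NZ // normN1 mul1r.
have fhw : (f - h) w = 0 by rewrite /= !fctE fh subrr.
have [g [Fg gE Ng]] := HD w (f - h) Kw Ffh fhw.
(* At [z = w] the value of [g] is unspecified, but the factor [delta w w = 0] removes it. *)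
have -> : f z = (h + delta z w *: g) z.
  rewrite /= !fctE /=; have [->|zw] := pselect (z = w).
    by rewrite ((parameter_eq0 hU w w).2 erefl) scale0r addr0.
  rewrite gE // scalerA divff ?scale1r ?fctE ?subrKC //.
  by apply/eqP => /(parameter_eq0 hU z w).1.
set nd := ComplexField.Normc.normc _.
have nd0 : 0 <= nd by exact: normc_ge0.
apply: le_trans (intermediate_norm_le _ (FD _ _ Fh (FZ _ _ Fg))) _.
apply: le_trans (ND _ _ Fh (FZ _ _ Fg)) _.
rewrite NZ // -/nd -mulrA ler_pM2l //.
have Nf0 := admissible_norm_ge0 Ff; have Nh0 := admissible_norm_ge0 Fh.
have Dk0 : 0 <= D * k by rewrite ltW // mulr_gt0.
have Ng' : N g <= D * k * (N f + N h).
  by apply: le_trans Ng _; rewrite -mulrA ler_pM2l.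
have := ler_wpM2l nd0 Ng'.
have := mulr_ge0 Dk0 Nh0.
have := mulr_ge0 nd0 (addr_ge0 Nf0 Nh0).
nra.
Qed.

End Family.
End AdmissibleFamilies.

Theorem theorem2p5 (R : realType) (U : topologicalType)
  (delta : U -> U -> R[i]) (hU : parameter_space delta)
  (Z W : topologicalLmodType R[i])
  (hZ : hausdorff_space Z) (hW : hausdorff_space W)
  (F : set (U -> Z)) (NF : (U -> Z) -> R) (hF : admissible delta F NF)
  (G : set (U -> W)) (NG : (U -> W) -> R) (hG : admissible delta G NG)
  (T : U -> Z -> W) (hT : interpolating F NF G NG T)
  (w0 : U)
  (hw0 : (0 < eta_op (intermediate F w0) (intermediate_norm F NF w0)
                (intermediate_norm G NG w0) (T w0))%E) :
  exists (omega : set U) (C : R),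
    [/\ nbhs w0 omega, 0 < C
      & forall z, omega z ->
          (C%:E <= eta_op (intermediate F z) (intermediate_norm F NF z)
                     (intermediate_norm G NG z) (T z))%E].
Proof.
have [K nK cK] : exists2 K, nbhs w0 K & compact K.
  have := parameter_locally_compact hU (x := w0) I.
  by rewrite withinET => -[K nK [cK _]]; exists K.
have q0 : 0 < 1 / 4 :> R by lra.
(* The supremum may be infinite; one admissible [c > 0] suffices. *)
have [_ [c Hc <-]] := ereal_sup_gt hw0; rewrite lte_fin => c0.
have [TG _ [M M0 TM]] := hT.
have [A A0 HA] := intermediate_norm_perturb hU hF cK.
have [B B0 HB] := intermediate_norm_perturb hU hG cK.
(* With [a] the norm of [x] at [z], [s] and [d1] will bound each term of the final estimate by
   [a / 4]; [C] and [d2] will bound each term of the estimate at [w0] by [c * s * a / 4]. *)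
have [s [s0 s1 As]] := ex_small_factor A0 q0.
have cs0 : 0 < c * s / 4 by rewrite divr_gt0 // mulr_gt0.
have [C [C0 C1 BC]] := ex_small_factor B0 cs0.
have A30 : 0 < A * 3 by rewrite mulr_gt0.
have [d1 [d10 _ Ad]] := ex_small_factor A30 q0.
have BM0 : 0 < B * (2 * M + 1) by rewrite mulr_gt0 // addr_gt0 // mulr_gt0.
have [d2 [d20 _ Bd]] := ex_small_factor BM0 cs0.
have d0 : 0 < Num.min d1 d2 by rewrite lt_min d10.
(* Keeping [z] in [K] allows a comparison based at [z] with the constant [B]. *)
exists (K `&` [set z |
  ComplexField.Normc.normc (delta w0 z) < Num.min d1 d2 /\
  ComplexField.Normc.normc (delta z w0) < Num.min d1 d2]), C; split => //.
  by apply: filterI => //; exact: nbhs_delta_small.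
have Kw0 : K w0 by exact: nbhs_singleton.
move=> z [Kz []]; rewrite !lt_min => /andP[_ dG] /andP[dF _].
apply: ereal_sup_ubound; exists C => //= x Xx.
set a := intermediate_norm F NF z x.
have := intermediate_norm_ge0 hF z x; rewrite -/a le_eqVlt => /orP[/eqP<-|a0].
  by rewrite mulr0; exact: intermediate_norm_ge0 hG _ _.
rewrite leNgt; apply/negP => Ca.
(* The infimum need not be attained; since [a > 0], the factor 2 leaves room for a
   representative. *)
have a2 : intermediate_norm F NF z x < 2 * a by rewrite -/a; lra.
have [f [Ff fz Nf]] := intermediate_norm_lt Xx a2.
have GTf := TG f Ff; have NTf := TM f Ff.
have XT : intermediate G z (T z x) by exists (fun w => T w (f w)); rewrite ?fz.
have [h [Gh hz Nh]] := intermediate_norm_lt XT Ca.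
have hTf : T z (f z) = h z by rewrite fz.
have := HB z w0 _ h Kz GTf Gh hTf.
have Xw0 : intermediate F w0 (f w0) by exists f.
have := Hc _ Xw0.
set e := ComplexField.Normc.normc _ in dG *; move=> cf Bf.
have fsmall : intermediate_norm F NF w0 (f w0) < s * a.
  have cNs : c * intermediate_norm F NF w0 (f w0) < c * (s * a).
    apply: le_lt_trans (le_trans cf Bf) _.
    have NG0 := admissible_norm_ge0 hG GTf; have Nh0 := admissible_norm_ge0 hG Gh.
    have Ch : C * a <= a by rewrite ger_pMl.
    have MN : M * NF f < M * (2 * a) by rewrite ltr_pM2l.
    (* This uses [C <= 1], through [NG h < C * a <= a]. *)
    have sum_le : NG (fun w => T w (f w)) + NG h <= (2 * M + 1) * a by lra.
    have e_sum : e * (NG (fun w => T w (f w)) + NG h) <= d2 * ((2 * M + 1) * a).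
      by apply: ler_pM => //; [exact: normc_ge0 | exact: addr_ge0 | exact: ltW].
    have := ler_wpM2r (ltW a0) Bd.
    have := ler_wpM2r (ltW a0) BC.
    have := ltr_pM2l B0 (NG h) (C * a); rewrite Nh => BNh.
    have := ler_wpM2l (ltW B0) e_sum.
    have : 0 < c * s * a by rewrite !mulr_gt0.
    lra.
  by rewrite ltr_pM2l in cNs.
have [g [Fg gw0 Ng]] := intermediate_norm_lt Xw0 fsmall.
(* The comparison is now based at [w0] and read at [z], the reverse of the one in the target
   scale. *)
have := HA w0 z f g Kw0 Ff Fg (esym gw0).
rewrite fz -/a.
set e' := ComplexField.Normc.normc _ in dF *.
(* The right-hand side is below [a / 4 + a / 4], which contradicts [a > 0]. *)
apply/negP; rewrite -ltNge.
have NF0 := admissible_norm_ge0 hF Ff; have Ng0 := admissible_norm_ge0 hF Fg.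
have sa : s * a <= a by rewrite ger_pMl.
have sum_le : NF f + NF g <= 3 * a by lra.
have e_sum : e' * (NF f + NF g) <= d1 * (3 * a).
  by apply: ler_pM => //; [exact: normc_ge0 | exact: addr_ge0 | exact: ltW].
have := ler_wpM2r (ltW a0) Ad.
have := ler_wpM2r (ltW a0) As.
have := ltr_pM2l A0 (NF g) (s * a); rewrite Ng => ANg.
have := ler_wpM2l (ltW A0) e_sum.
lra.
Qed.
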